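(* Let $(f_1,f_2)$ range over all bent vectorial functions from $\mathrm{GF}(2^4)$ to $\mathrm{GF}(2)^2$. Then every code $\mathcal{C}(f_1,f_2)$ is a binary $[16,7,6]$ code, and all such codes are equivalent to one another; i.e., up to equivalence there is exactly one $[16,7,6]$ code obtainable as $\mathcal{C}(f_1,f_2)$ from a $(4,2)$ bent vectorial function.
   Context: Write $\mathrm{GF}(2^{4})=\{u_1,\dots,u_{16}\}$ and let $\mathrm{tr}_{4/1}$ be the absolute trace to $\mathrm{GF}(2)$. A Boolean function $f:\mathrm{GF}(2^{4})\to\mathrm{GF}(2)$ is bent if $\left|\sum_{x}(-1)^{f(x)+\mathrm{tr}_{4/1}(wx)}\right|=4$ for all $w\in\mathrm{GF}(2^4)$. A pair $(f_1,f_2)$ of Boolean functions is a bent vectorial function if $f_1$, $f_2$ and $f_1+f_2$ are all bent. The truth table of $f$ is $(f(u_1),\dots,f(u_{16}))$. $\mathrm{RM}_2(1,4)=\{(\mathrm{tr}_{4/1}(bu_i)+c)_{i=1}^{16}: b\in\mathrm{GF}(2^4),c\in\mathrm{GF}(2)\}$, and $\mathcal{C}(f_1,f_2)$ is the binary linear code spanned by $\mathrm{RM}_2(1,4)$ and the truth tables of $f_1,f_2$. Two binary codes of the same length are equivalent if some permutation of coordinates maps one onto the other. *)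

(* Defs.v *)
From HB Require Import structures.
From mathcomp Require Import all_boot all_order all_algebra all_fingroup all_field.

Set Implicit Arguments.
Unset Strict Implicit.
Unset Printing Implicit Defensive.

Import GRing.Theory.
Local Open Scope ring_scope.

Section Trace.
Variable F : finFieldType.

Definition frobenius_sum (x : F) : F := \sum_(i < 4) x ^+ (2 ^ i).

(* The absolute trace as an 'F_2-valued map: for #|F| = 16 the Frobenius sum
   is 0 or 1 in F, and tr reads it in 'F_2 (see trE). *)
Definition tr (x : F) : 'F_2 := (frobenius_sum x != 0)%:R.

Lemma trE (x : F) : #|F| = 16 -> (tr x : nat)%:R = frobenius_sum x.
Proof.
move=> cF; have ch2 : 2 \in [pchar F] by apply: (@card_finPcharP _ 2 4).
have idem : frobenius_sum x * frobenius_sum x = frobenius_sum x.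
  rewrite -expr2 -(pFrobenius_autE ch2) /frobenius_sum rmorph_sum /=.
  under eq_bigr => i _ do rewrite pFrobenius_autE -exprM -expnSr.
  have x16 : x ^+ 16 = x by rewrite -[RHS]expf_card cF.
  rewrite big_ord_recr [RHS]big_ord_recl /= x16 expr1 addrC.
  by congr (_ + _); apply: eq_bigr.
rewrite /tr; case: eqVneq => [-> //|nz] /=.
by apply: (mulfI nz); rewrite idem mulr1.
Qed.

Definition bent (f : F -> 'F_2) : Prop :=
  forall w : F, `|\sum_(x : F) (-1 : int) ^+ (f x + tr (w * x))%R| = 4.

Definition bent_vectorial (f1 f2 : F -> 'F_2) : Prop :=
  [/\ bent f1, bent f2 & bent (fun x => f1 x + f2 x)].

Variable u : 'I_16 -> F.

Definition truth_table (f : F -> 'F_2) : 'rV['F_2]_16 := \row_i f (u i).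

Definition RM14 : {set 'rV['F_2]_16} :=
  [set truth_table (fun x => tr (b * x) + c) | b : F, c : 'F_2].

Definition bent_code (f1 f2 : F -> 'F_2) : {vspace 'rV['F_2]_16} :=
  <<[:: truth_table f1, truth_table f2 & enum RM14]>>%VS.

End Trace.

Definition hamming_dist (n : nat) (x y : 'rV['F_2]_n) : nat :=
  #|[set i | x 0 i != y 0 i]|.

Definition min_dist (n : nat) (C : {vspace 'rV['F_2]_n}) (d : nat) : Prop :=
  (exists x y, [/\ x \in C, y \in C, x != y & hamming_dist x y = d]) /\
  (forall x y, x \in C -> y \in C -> x != y -> (d <= hamming_dist x y)%N).

Definition is_code (n k d : nat) (C : {vspace 'rV['F_2]_n}) : Prop :=
  \dim C = k /\ min_dist C d.

Definition code_equiv (n : nat) (C D : {vspace 'rV['F_2]_n}) : Prop :=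
  exists s : 'S_n, [set col_perm s x | x in C] = [set y in D].

(* Main.v *)
Require Import Defs.
From mathcomp Require Import all_boot all_order all_algebra all_fingroup all_field.
From mathcomp Require Import ring zify.

Set Implicit Arguments.
Unset Strict Implicit.
Unset Printing Implicit Defensive.

(* A bent function on GF(16) is a function all of whose sums with affine functions have
   weight 6 or 10, so a nonzero word of C(f1, f2) has weight 6, 8, 10 or 16 and its 2^7
   parameters give distinct words.  For the uniqueness, the coordinates tr(e_i x) of a basis
   e identify GF(16) with bit vectors and the functions tr(b x) with all linear forms.
   Modulo affine functions there are 28 bent functions, and 56 planes consist of bent
   functions and zero; the group 2^3:7 of linear maps permutes them regularly.  Hence each
   C(f1, f2) is carried by one of 56 linear maps to the code of the multiplication of GF(4),
   which is checked by enumeration. *)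

Import GRing.Theory Num.Theory.

(** * Boolean words over the 16 bit vectors, and the finite enumerations *)

Fixpoint bitseqs (n : nat) : seq bitseq :=
  if n is n'.+1 then
    [seq false :: s | s <- bitseqs n'] ++ [seq true :: s | s <- bitseqs n']
  else [:: [::]].

Lemma mem_bitseqs n s : (s \in bitseqs n) = (size s == n).
Proof.
elim: n s => [|n IHn] [|b s] //=; rewrite mem_cat.
  by apply/negP => /orP[] /mapP[].
rewrite eqSS -IHn; apply/orP/idP => [[] /mapP[t ht [_ ->]] //|hs].
by case: b; [right|left]; rewrite map_f.
Qed.

Local Notation pts := (bitseqs 4).

Definition bitdot (s t : bitseq) : bool :=
  foldr addb false [seq x.1 && x.2 | x <- zip s t].

Definition bitadd (s t : bitseq) : bitseq :=
  [seq x.1 (+) x.2 | x <- zip s t].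

(** A word lists the values of a function in the order of [pts]; 6 and 10 are the weights [w] with
    [|16 - 2w| = 4]. *)
Definition bentb (v : bitseq) : bool :=
  all (fun c =>
    count (fun x => x.1 (+) bitdot c x.2) (zip v pts) \in [:: 6; 10]) pts.

(* The words vanishing at the origin and at the four unit vectors, which sit at positions
   0, 1, 2, 4 and 8 of [bitseqs 4]. *)
Definition normal_word (t : bitseq) : bitseq :=
  if t is [:: a; b; c; d; e; f; g; h; i; j; k] then
    [:: false; false; false; a; false; b; c; d;
        false; e; f; g; h; i; j; k]
  else [::].

Definition normal_bents : seq bitseq :=
  [seq v <- [seq normal_word t | t <- bitseqs 11] | bentb v].

(* The two coordinates of the product of two elements of GF(4) written in the basis
   (1, w) with w^2 = w + 1. *)
Definition gf4_mul1 (s : bitseq) : bool :=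
  if s is [:: x; y; z; t] then x && z (+) y && t else false.

Definition gf4_mul2 (s : bitseq) : bool :=
  if s is [:: x; y; z; t] then x && t (+) y && z (+) y && t else false.

(** All 128 words of the reference code: [p] gives the coefficients of the two bent functions, [q]
    the linear form and the constant. *)
Definition gf4_code : seq bitseq :=
  [seq [seq ((p.1 && gf4_mul1 s) (+) (p.2 && gf4_mul2 s))
            (+) (bitdot q.1 s (+) q.2) | s <- pts]
  | p <- [seq (a, b) | a <- [:: false; true], b <- [:: false; true]],
    q <- [seq (c, e) | c <- pts, e <- [:: false; true]]].

(** The shift register of the recurrence with characteristic polynomial [X^3 + X + 1], which is
    primitive, acting on the first three bits. *)
Definition singer (s : bitseq) : bitseq :=
  if s is [:: x; y; z; t] then [:: y; z; x (+) y; t] else s.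

Definition transvection (a s : bitseq) : bitseq :=
  if (a, s) is ([:: a; b; c], [:: x; y; z; t]) then
    [:: x (+) a && t; y (+) b && t; z (+) c && t; t]
  else s.

Definition linear_map (g : nat * bitseq) (s : bitseq) : bitseq :=
  iter g.1 singer (transvection g.2 s).

(* The group 2^3:7 fixing the last coordinate: [singer] has order 7. *)
Definition linear_maps : seq (nat * bitseq) :=
  [seq (i, a) | i <- iota 0 7, a <- bitseqs 3].

(** Linearity is expressed dually, as stability of the linear forms under composition with [A]; this
    is the form in which it acts on the functions [tr (b * x)]. *)
Definition linear_perm (A : bitseq -> bitseq) : bool :=
  [&& all (fun s => A s \in pts) pts,
      all (fun s => all (fun t => (A s == A t) ==> (s == t)) pts) pts
    & all (fun c => has (fun d =>
        all (fun s => bitdot c (A s) == bitdot d s) pts) pts) pts].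

Lemma linear_map_linear_perm : all (fun g => linear_perm (linear_map g)) linear_maps.
Proof. by vm_compute. Qed.

Definition pullback (j : seq nat) (v : bitseq) := [seq nth false v i | i <- j].

(** Each map is tabulated as positions in [pts], so that composing a word with it is mere
    indexing. *)
Definition linear_tables : seq (seq nat) :=
  [seq [seq index (linear_map g s) pts | s <- pts] | g <- linear_maps].

(* [lazy] stops at the first failing conjunct, which the call-by-value VM does not. *)
Lemma normal_bents_classification :
  all (fun v => all (fun w => bentb (bitadd v w) ==>
    has (fun j => (pullback j v \in gf4_code) && (pullback j w \in gf4_code))
      linear_tables) normal_bents) normal_bents.
Proof. by lazy. Qed.

Lemma gf4_bent :
  [/\ bentb [seq gf4_mul1 s | s <- pts], bentb [seq gf4_mul2 s | s <- pts]
    & bentb [seq gf4_mul1 s (+) gf4_mul2 s | s <- pts]].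
Proof. by split; vm_compute. Qed.

Lemma bitdot_balanced c :
  c \in pts -> c != nseq 4 false -> count (bitdot c) pts = 8.
Proof.
have: all (fun c => (c != nseq 4 false) ==> (count (bitdot c) pts == 8)) pts.
  by vm_compute.
by move=> /allP h /h /implyP h' /h' /eqP.
Qed.

Local Open Scope ring_scope.

(** * Elements of ['F_2] as Booleans *)

Lemma F2_neq0E (a : 'F_2) : a = (a != 0)%:R.
Proof. by case: a => [[|[|?]] ?]; apply/val_inj. Qed.

Lemma F2_addb (a b : 'F_2) : (a + b != 0) = (a != 0) (+) (b != 0).
Proof. by case: a b => [[|[|?]] ?] [[|[|?]] ?]. Qed.

Lemma F2_natr_addb (a b : bool) : (a (+) b)%:R = a%:R + b%:R :> 'F_2.
Proof. by case: a b => [] []; apply/val_inj. Qed.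

Lemma F2_natr_neq0 (a : bool) : ((a%:R : 'F_2) != 0) = a.
Proof. by case: a. Qed.

Lemma F2_addrr (a : 'F_2) : a + a = 0.
Proof. by case: a => [[|[|?]] ?]; apply/val_inj. Qed.

Lemma F2_cases (a : 'F_2) : a = 0 \/ a = 1.
Proof. by case: a => [[|[|?]] ?] //; [left|right]; apply/val_inj. Qed.

(** * Additivity and nondegeneracy of the trace on GF(16) *)

Section Field16.
Variable F : finFieldType.
Hypothesis cardF : #|F| = 16%N.
Implicit Types (f g : F -> 'F_2) (b x y z : F).

Lemma pchar_field16 : 2 \in [pchar F].
Proof. exact: (@card_finPcharP _ 2 4). Qed.

Lemma frobenius_sumD x y :
  frobenius_sum (x + y) = frobenius_sum x + frobenius_sum y.
Proof.
rewrite /frobenius_sum -big_split /=; apply: eq_bigr => i _.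
by rewrite exprDn_pchar // pnatX pnatE ?pchar_field16.
Qed.

Lemma F2_natr_inj : injective (fun a : 'F_2 => (a : nat)%:R : F).
Proof.
have n10 := oner_neq0 F.
move=> a b; case: (F2_cases a) (F2_cases b) => -> [] -> //= /eqP.
  by rewrite eq_sym (negPf n10).
by rewrite (negPf n10).
Qed.

Lemma F2_natrD (a b : 'F_2) : ((a + b)%R : nat)%:R = (a : nat)%:R + (b : nat)%:R :> F.
Proof.
have h2 := addrr_pchar2 pchar_field16.
by case: (F2_cases a) (F2_cases b) => -> [] -> //=; rewrite ?addr0 ?add0r ?h2.
Qed.

(** Since [tr] is defined by a test, additivity is checked after embedding ['F_2] into [F], where
    the trace becomes the Frobenius sum. *)
Lemma trD x y : tr (x + y) = tr x + tr y.
Proof.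
by apply: F2_natr_inj; rewrite /= F2_natrD !trE // frobenius_sumD.
Qed.

Lemma tr0 : tr (0 : F) = 0.
Proof.
rewrite /tr /frobenius_sum big1 ?eqxx // => i _.
by rewrite expr0n expn_eq0.
Qed.

(** Otherwise the polynomial [X + X^2 + X^4 + X^8], of degree 8, would have 16 roots. *)
Lemma exists_tr_neq0 : exists x : F, tr x != 0.
Proof.
case: (boolP [exists x : F, tr x != 0]) => [/existsP //|/existsPn h0].
exfalso.
pose P : {poly F} := \sum_(i < 4) 'X^(2 ^ i).
have sP : (size P <= 9)%N.
  apply: leq_trans (size_sum _ _ _) _; apply/bigmax_leqP => i _.
  by rewrite size_polyXn ltnS (@leq_pexp2l 2 i 3) // -ltnS.
have P0 : P != 0.
  apply/eqP => /(congr1 (fun Q : {poly F} => Q`_8)).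
  rewrite /P coef_sum !big_ord_recr big_ord0 /= !coefXn coef0 /= !add0r.
  exact/eqP/oner_neq0.
have rP : all (root P) (enum F).
  apply/allP => x _; rewrite /root horner_sum.
  under eq_bigr do rewrite hornerXn.
  have := h0 x; rewrite negbK => /eqP e.
  by rewrite -/(frobenius_sum x) -trE // e.
have := max_poly_roots P0 rP (enum_uniq F).
by rewrite -cardE cardF => /leq_trans/(_ sP).
Qed.

Lemma tr_nondegenerate b : b != 0 -> exists x, tr (b * x) != 0.
Proof.
by move=> b0; have [x hx] := exists_tr_neq0; exists (b^-1 * x); rewrite mulVKf.
Qed.

(** * Bit coordinates on GF(16) *)

Lemma field16_basis : exists e : 'I_4 -> F,
  forall x, exists c : 'I_4 -> bool, x = \sum_i (c i)%:R * e i.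
Proof.
pose V : vectType 'F_2 := pPrimeCharType pchar_field16.
have dV : \dim {: V}%VS = 4.
  by rewrite (pprimeChar_dimf pchar_field16) cardF.
(* The type of the basis mentions the dimension, so the basis and its expansion property are
   generalized together before the dimension becomes 4. *)
move: (vbasis {: V}%VS) (@coord_vbasis _ V ^~ fullv); rewrite dV => B hB.
exists (fun i : 'I_4 => B`_i) => x; exists (fun i => coord B i (x : V) != 0).
rewrite {1}(hB x (memvf _)); apply: eq_bigr => i _.
by case: (F2_cases (coord B i (x : V))) => ->; rewrite ?scale0r ?scale1r ?mul0r ?mul1r.
Qed.

(** Bentness sees [F] only through the functions [tr (b * x)]; the chart therefore matches these
    with the linear forms on bit vectors, in both directions. *)
Record trace_chart (p : bitseq -> F) (q : F -> bitseq) : Prop := TraceChart {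
  chart_pts : forall x, q x \in pts;
  chart_ptsK : {in pts, cancel p q};
  chart_fieldK : cancel q p;
  chart_tr : forall b, exists2 c, c \in pts & forall x, tr (b * x) = (bitdot c (q x))%:R;
  chart_dot : forall c, c \in pts -> exists b, forall x, tr (b * x) = (bitdot c (q x))%:R
}.

(* The coordinates of [x] are the [tr (e_i * x)] for a basis [e] of [F] over 'F_2. *)
Lemma exists_trace_chart : exists p q, trace_chart p q.
Proof.
have [e he] := field16_basis.
pose q x : bitseq := [seq tr (e i * x) != 0 | i <- enum 'I_4].
have qE x : q x = [:: tr (e 0 * x) != 0; tr (e 1 * x) != 0;
                      tr (e 2%:R * x) != 0; tr (e 3%:R * x) != 0].
  rewrite /q !enum_ordSl enum_ord0 /=.
  by congr [:: tr (e _ * _) != 0; tr (e _ * _) != 0; tr (e _ * _) != 0;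
               tr (e _ * _) != 0]; apply/val_inj.
have trq (c : 'I_4 -> bool) x : tr ((\sum_i (c i)%:R * e i) * x) =
    (bitdot [:: c 0; c 1; c 2%:R; c 3%:R] (q x))%:R.
  rewrite qE /bitdot /= !F2_natr_addb !big_ord_recl big_ord0 !mulrDl !trD.
  rewrite mul0r tr0; congr (_ + (_ + (_ + (_ + _)))).
  - by case: (c 0); rewrite ?mul0r ?mul1r ?tr0 // -F2_neq0E.
  - rewrite (_ : lift ord0 ord0 = 1); last exact/val_inj.
    by case: (c 1); rewrite ?mul0r ?mul1r ?tr0 // -F2_neq0E.
  - rewrite (_ : lift ord0 (lift ord0 ord0) = 2%:R); last exact/val_inj.
    by case: (c 2%:R); rewrite ?mul0r ?mul1r ?tr0 // -F2_neq0E.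
  - rewrite (_ : lift ord0 (lift ord0 (lift ord0 ord0)) = 3%:R); last exact/val_inj.
    by case: (c 3%:R); rewrite ?mul0r ?mul1r ?tr0 // -F2_neq0E.
have q_pts x : q x \in pts by rewrite qE mem_bitseqs.
(* Some [tr (b * (x - y))] is nonzero if [x != y], and it is a combination of the coordinates of [x]
   and [y]. *)
have q_inj : injective q.
  move=> x y eq_xy; apply/eqP; rewrite -subr_eq0; apply: contraT => xy0.
  have [b] := tr_nondegenerate xy0; rewrite mulrC mulrBr.
  have [c ->] := he b; rewrite -mulrN trD !trq.
  have N1 : -1 = 1 :> F by rewrite oppr_pchar2 // pchar_field16.
  by rewrite -[- y]mulN1r N1 mul1r eq_xy F2_addrr eqxx.
have q_onto s : s \in pts -> exists x, q x = s.
  move=> hs; have sub : {subset [seq q x | x <- enum F] <= pts}.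
    by move=> _ /mapP[x _ ->].
  have uq : uniq [seq q x | x <- enum F] by rewrite map_inj_uniq ?enum_uniq.
  have [//|_ eqi] := uniq_min_size uq sub.
    by rewrite size_map -cardE cardF.
  by move: hs; rewrite -eqi => /mapP[x _ ->]; exists x.
(* By surjectivity the default 0 is never reached on [pts]. *)
exists (fun s => odflt 0 [pick x | q x == s]), q; split => //.
- move=> s /q_onto[x hx]; case: pickP => [y /eqP //|/(_ x)].
  by rewrite hx eqxx.
- by move=> x; case: pickP => [y /eqP/q_inj //|/(_ x)]; rewrite eqxx.
- move=> b; have [c ->] := he b.
  by exists [:: c 0; c 1; c 2%:R; c 3%:R]; [rewrite mem_bitseqs|exact: trq].
- move=> c; rewrite mem_bitseqs => /eqP sc.
  exists (\sum_i (nth false c (i : 'I_4))%:R * e i) => x; rewrite trq.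
  by congr (bitdot _ _)%:R; move: c sc => [|? [|? [|? [|? []]]]].
Qed.

(** * Weights of bent and affine functions *)

Definition weight g := #|[set x | g x != 0]|.

Lemma eq_weight f g : f =1 g -> weight f = weight g.
Proof. by move=> h; apply: eq_card => x; rewrite !inE h. Qed.

Lemma weight_chart p q g : trace_chart p q ->
  weight g = count (fun s => g (p s) != 0) pts.
Proof.
move=> H.
have pq : perm_eq (enum F) [seq p s | s <- pts].
  apply: uniq_perm; first exact: enum_uniq.
    rewrite map_inj_in_uniq // => s t hs ht /(congr1 q).
    by rewrite !(chart_ptsK H).
  move=> x; rewrite mem_enum inE -[x](chart_fieldK H) map_f //.
  exact: chart_pts H x.
rewrite /weight cardE /enum_mem -enumT size_filter.
rewrite (seq.permP pq) count_map; apply: eq_count => s /=.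
by rewrite inE.
Qed.

Lemma sum_signs g :
  \sum_(x : F) (-1 : int) ^+ (g x) = 16%:R - (weight g)%:R *+ 2.
Proof.
transitivity (\sum_(x : F) (1 - (g x != 0)%:R *+ 2 : int)).
  by apply: eq_bigr => x _; case: (F2_cases (g x)) => ->.
rewrite sumrB sumr_const cardF; congr (_ - _).
rewrite sumrMnl; congr (_ *+ 2); rewrite /weight cardsE -sum1_card.
by rewrite natr_sum [RHS]big_mkcond; apply: eq_bigr => x _; rewrite unfold_in /=; case: (g x != 0).
Qed.

Lemma weight_compl g : (weight (fun x => g x + 1)%R + weight g = 16)%N.
Proof.
rewrite -cardF -(cardC [set x | g x != 0]) addnC; congr (_ + _)%N.
apply: eq_card => x; rewrite !inE.
by case: (F2_cases (g x)) => ->.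
Qed.

Lemma bent_weight f : bent f <->
  forall w, weight (fun x => f x + tr (w * x)) \in [:: 6; 10]%N.
Proof.
split=> h w; have := h w; rewrite (sum_signs (fun x => f x + tr (w * x))).
  have := weight_compl (fun x => f x + tr (w * x)).
  move: (weight _) (weight _) => m n le; rewrite !inE; lia.
by rewrite !inE => /orP[] /eqP ->.
Qed.

(** Adding the constant 1 turns weight [w] into [16 - w], which exchanges 6 and 10. *)
Lemma bent_affine_weight f b (c : 'F_2) : bent f ->
  weight (fun x => f x + (tr (b * x) + c)) \in [:: 6; 10]%N.
Proof.
move=> /bent_weight /(_ b) h.
case: (F2_cases c) => ->.
  by rewrite (eq_weight (_ : _ =1 fun x => f x + tr (b * x))) // => x; rewrite addr0.
rewrite (eq_weight (_ : _ =1 fun x => f x + tr (b * x) + 1)) => [|x]; last by rewrite addrA.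
have := weight_compl (fun x => f x + tr (b * x)).
by move: h; rewrite !inE => /orP[] /eqP ->; lia.
Qed.

Lemma bent_add_affine f b (c : 'F_2) :
  bent f -> bent (fun x => f x + (tr (b * x) + c)).
Proof.
move=> bf; apply/bent_weight => w.
rewrite (eq_weight (_ : _ =1 fun x => f x + (tr ((b + w) * x) + c))).
  exact: bent_affine_weight.
by move=> x; rewrite mulrDl trD; ring.
Qed.

Lemma affine_weight b (c : 'F_2) : b != 0 ->
  weight (fun x => tr (b * x) + c) = 8%N.
Proof.
move=> b0; have [p [q H]] := exists_trace_chart.
have w8 : weight (fun x => tr (b * x)) = 8%N.
  have [d hd bd] := chart_tr H b.
  rewrite (weight_chart _ H) -(bitdot_balanced hd).
    by apply: eq_in_count => s hs; rewrite bd F2_natr_neq0 (chart_ptsK H).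
  (* The form [d] is nonzero because it takes the value 1 at some point. *)
  have [x] := tr_nondegenerate b0; rewrite bd F2_natr_neq0; apply: contraTneq => ->.
  by have := chart_pts H x; move: (q x) => s; move: s; apply/allP; vm_compute.
case: (F2_cases c) => ->.
  by rewrite -w8; apply: eq_weight => x; rewrite addr0.
by have := weight_compl (fun x => tr (b * x)); rewrite w8; lia.
Qed.

Definition bent_comb f g (a1 a2 : 'F_2) (b : F) (c : 'F_2) : F -> 'F_2 :=
  fun x => a1 * f x + a2 * g x + (tr (b * x) + c).

Lemma bent_combD f g a1 a2 b c a1' a2' b' c' x :
  bent_comb f g a1 a2 b c x + bent_comb f g a1' a2' b' c' x =
  bent_comb f g (a1 + a1') (a2 + a2') (b + b') (c + c') x.
Proof. by rewrite /bent_comb (mulrDl b) trD; ring. Qed.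

(** If [a1] or [a2] is nonzero, the function is [f], [g] or [f + g] plus an affine function, of
    weight 6 or 10. Otherwise it is affine: of weight 8, or the constant 1 of weight 16. *)
Lemma bent_comb_weight f g a1 a2 b c : bent_vectorial f g ->
  (a1, a2, b, c) != 0 -> weight (bent_comb f g a1 a2 b c) \in [:: 6; 8; 10; 16]%N.
Proof.
move=> [bf bg bfg].
have sub h : (forall x, bent_comb f g a1 a2 b c x = h x + (tr (b * x) + c)) ->
    bent h -> weight (bent_comb f g a1 a2 b c) \in [:: 6; 8; 10; 16]%N.
  move=> eh /(bent_affine_weight b c); rewrite (eq_weight eh) !inE.
  by move=> /orP[] ->; rewrite ?orbT.
case: (F2_cases a1) (F2_cases a2) sub => -> [] -> sub.
- have [->|e0 _] := eqVneq b 0; last first.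
    rewrite (eq_weight (_ : _ =1 fun x => tr (b * x) + c)) ?affine_weight //.
    by move=> x; rewrite /bent_comb !mul0r !add0r.
  case: (F2_cases c) => -> nz; first by case/eqP: nz.
  rewrite (eq_weight (_ : _ =1 fun=> 1)).
    by rewrite /weight (_ : [set x : F | (1 : 'F_2) != 0] = setT) ?cardsT ?cardF.
  by move=> x; rewrite /bent_comb !mul0r tr0 !add0r.
- by move=> _; apply: (sub g) => // x; rewrite /bent_comb mul0r mul1r add0r.
- by move=> _; apply: (sub f) => // x; rewrite /bent_comb mul0r mul1r addr0.
- by move=> _; apply: (sub (fun x => f x + g x)) => // x; rewrite /bent_comb !mul1r.
Qed.

(** * The code: parameters, minimum distance, and equivalence by substitution *)

Section Code.
Variable u : 'I_16 -> F.

Lemma truth_tableD f g :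
  truth_table u f + truth_table u g = truth_table u (fun x => f x + g x).
Proof. by apply/rowP => i; rewrite !mxE. Qed.

Lemma eq_truth_table f g : f =1 g -> truth_table u f = truth_table u g.
Proof. by move=> fg; apply/rowP => i; rewrite !mxE. Qed.

Lemma bent_codeP f g v :
  reflect (exists a1 a2 b c, v = truth_table u (bent_comb f g a1 a2 b c))
    (v \in bent_code u f g).
Proof.
apply: (iffP idP) => [|[a1 [a2 [b [c ->]]]]]; last first.
  have sF (d : 'F_2) w : w \in bent_code u f g -> d *: w \in bent_code u f g.
    exact: rpredZ.
  rewrite (_ : truth_table u _ = a1 *: truth_table u f + a2 *: truth_table u g
      + truth_table u (fun x => tr (b * x) + c)); last first.
    by apply/rowP => i; rewrite !mxE.
  rewrite !rpredD ?sF //; apply: memv_span; rewrite !inE ?eqxx ?orbT //.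
  by rewrite mem_enum (imset2_f (fun b c => _)) ?orbT.
(* [S] contains 0 and the generators and is closed under sums; as scalars are 0 or 1, it contains
   the span. *)
pose S v := exists a1 a2 b c, v = truth_table u (bent_comb f g a1 a2 b c).
have S0 : S 0.
  exists 0, 0, 0, 0; apply/rowP => i.
  by rewrite !mxE /bent_comb !mul0r tr0 !addr0.
have SD v1 v2 : S v1 -> S v2 -> S (v1 + v2).
  move=> [a1 [a2 [b [c ->]]]] [a1' [a2' [b' [c' ->]]]].
  exists (a1 + a1'), (a2 + a2'), (b + b'), (c + c').
  by rewrite truth_tableD; apply: eq_truth_table => x; rewrite bent_combD.
rewrite /bent_code; set X := [:: _, _ & _] => vX.
have SX w : w \in X -> S w.
  rewrite !inE mem_enum => /or3P[/eqP ->|/eqP ->|/imset2P[b c _ _ ->]].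
  - exists 1, 0, 0, 0; apply: eq_truth_table => x.
    by rewrite /bent_comb !mul0r tr0 mul1r !addr0.
  - exists 0, 1, 0, 0; apply: eq_truth_table => x.
    by rewrite /bent_comb !mul0r tr0 mul1r add0r !addr0.
  - exists 0, 0, b, c; apply: eq_truth_table => x.
    by rewrite /bent_comb !mul0r !add0r.
rewrite (coord_span (X := in_tuple X) vX); apply: (big_ind S) => // i _.
case: (F2_cases (coord (in_tuple X) i v)) => ->; first by rewrite scale0r.
by rewrite scale1r; apply: SX; rewrite mem_nth.
Qed.

Hypothesis bij_u : bijective u.

Lemma hamming_dist_truth_table f g :
  hamming_dist (truth_table u f) (truth_table u g) = weight (fun x => f x + g x).
Proof.
rewrite /weight -(on_card_preimset (onW_bij _ bij_u)).
suff -> : u @^-1: [set x | f x + g x != 0] =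
    [set i | truth_table u f 0 i != truth_table u g 0 i] by [].
apply/setP => i; rewrite !inE !mxE F2_addb.
by case: (F2_cases (f (u i))) (F2_cases (g (u i))) => -> [] ->.
Qed.

Lemma weight_truth_table_eq f g : truth_table u f = truth_table u g ->
  weight (fun x => f x + g x) = 0%N.
Proof.
move=> e; rewrite -hamming_dist_truth_table e /hamming_dist.
by apply: eq_card0 => i; rewrite !inE eqxx.
Qed.

Lemma field16_addr_eq0 (x y : F) : x + y = 0 -> x = y.
Proof.
by move/eqP; rewrite addr_eq0 => /eqP ->; rewrite oppr_pchar2 // pchar_field16.
Qed.

Lemma F2_addr_eq0 (x y : 'F_2) : x + y = 0 -> x = y.
Proof. by case: (F2_cases x) (F2_cases y) => -> [] ->. Qed.

Lemma bent_index_eq (t t' : 'F_2 * 'F_2 * F * 'F_2) : t + t' = 0 -> t = t'.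
Proof.
move: t t' => [[[a1 a2] b] c] [[[a1' a2'] b'] c'] /eqP.
change ((a1 + a1', a2 + a2', b + b', c + c') == (0, 0, 0, 0) ->
  (a1, a2, b, c) = (a1', a2', b', c')).
rewrite !xpair_eqE => /andP[/andP[/andP[/eqP/F2_addr_eq0 -> /eqP/F2_addr_eq0 ->]]].
by move=> /eqP/field16_addr_eq0 -> /eqP/F2_addr_eq0 ->.
Qed.

(** Two parameters giving the same word have a sum of weight 0, so this sum is the zero
    parameter. *)
Lemma card_bent_code f g : bent_vectorial f g -> #|bent_code u f g| = 128%N.
Proof.
move=> bv.
pose tt (t : 'F_2 * 'F_2 * F * 'F_2) :=
  truth_table u (bent_comb f g t.1.1.1 t.1.1.2 t.1.2 t.2).
have tt_inj : injective tt.
  move=> [[[a1 a2] b] c] [[[a1' a2'] b'] c'] /weight_truth_table_eq /=.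
  rewrite (eq_weight (bent_combD _ _ _ _ _ _ _ _ _ _)) => w0.
  by apply/bent_index_eq/eqP/contraT => /(bent_comb_weight bv); rewrite w0.
rewrite (_ : #|_| = #|[set tt t | t : 'F_2 * 'F_2 * F * 'F_2]|).
  by rewrite card_imset // !card_prod cardF !card_Fp.
apply: eq_card => v; apply/bent_codeP/imsetP => [[a1 [a2 [b [c ->]]]]|].
  by exists (a1, a2, b, c).
by move=> [[[[a1 a2] b] c] _ ->]; exists a1, a2, b, c.
Qed.

Lemma bent_code_is_code f g : bent_vectorial f g -> is_code 7 6 (bent_code u f g).
Proof.
move=> bv; split.
  have := card_vspace (bent_code u f g); rewrite card_bent_code // card_Fp //.
  by move/eqP; rewrite -[128%N]/(2 ^ 7)%N eqn_exp2l // => /eqP.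
have dist_ge v w : v \in bent_code u f g -> w \in bent_code u f g -> v != w ->
    (6 <= hamming_dist v w)%N.
  move=> /bent_codeP[a1 [a2 [b [c ->]]]] /bent_codeP[a1' [a2' [b' [c' ->]]]] vw.
  rewrite hamming_dist_truth_table (eq_weight (bent_combD _ _ _ _ _ _ _ _ _ _)).
  have /(bent_comb_weight bv) : (a1 + a1', a2 + a2', b + b', c + c') != 0.
    apply: contraNneq vw => e.
    have := @bent_index_eq (a1, a2, b, c) (a1', a2', b', c') e.
    by case/pair_equal_spec => /pair_equal_spec[/pair_equal_spec[-> ->] ->] ->.
  by rewrite !inE => /or4P[] /eqP ->.
split=> //.
(* The distance 6 is attained between 0 and whichever of [f] and [f + 1] has weight 6. *)
have [c w6] : exists c, weight (bent_comb f g 1 0 0 c) = 6%N.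
  have fE c : bent_comb f g 1 0 0 c =1 fun x => f x + c.
    by move=> x; rewrite /bent_comb !mul0r mul1r tr0 addr0 add0r.
  have [/bent_weight/(_ 0) w _ _] := bv.
  have {}w : weight f \in [:: 6; 10]%N.
    rewrite (eq_weight (_ : _ =1 fun x => f x + tr (0 * x))) //.
    by move=> x; rewrite mul0r tr0 addr0.
  move: w; rewrite !inE => /orP[] /eqP wf.
    by exists 0; rewrite (eq_weight (fE _)) -wf; apply: eq_weight => x; rewrite addr0.
  exists 1; rewrite (eq_weight (fE _)).
  by have := weight_compl f; rewrite wf; lia.
have z0 x : bent_comb f g 0 0 0 0 x = 0 by rewrite /bent_comb !mul0r tr0 !addr0.
exists (truth_table u (bent_comb f g 1 0 0 c)), (truth_table u (bent_comb f g 0 0 0 0)).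
have d6 : hamming_dist (truth_table u (bent_comb f g 1 0 0 c))
    (truth_table u (bent_comb f g 0 0 0 0)) = 6%N.
  by rewrite hamming_dist_truth_table -w6; apply: eq_weight => x; rewrite z0 addr0.
split=> //; try by apply/bent_codeP; do 4!eexists.
apply/eqP => e; move: d6; rewrite e /hamming_dist eq_card0 // => i.
by rewrite !inE eqxx.
Qed.

(** Substituting [P] permutes the coordinates and maps the first code into the second; both have 128
    words, so the inclusion is an equality. *)
Lemma bent_code_equiv f1 f2 g1 g2 (P : F -> F) :
    bent_vectorial f1 f2 -> bent_vectorial g1 g2 -> injective P ->
    (forall a1 a2 b c, exists a1' a2' b' c',
      forall x, bent_comb f1 f2 a1 a2 b c (P x) = bent_comb g1 g2 a1' a2' b' c' x) ->
  code_equiv (bent_code u f1 f2) (bent_code u g1 g2).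
Proof.
move=> bvf bvg injP combP; have [u' uK u'K] := bij_u.
have inj_s : injective (fun i => u' (P (u i))).
  by move=> i j /(can_inj u'K)/injP/(can_inj uK).
exists (perm inj_s); apply/eqP; rewrite eqEcard cardsE card_bent_code //.
have inj_c : injective (@col_perm 'F_2 1 16 (perm inj_s)).
  by move=> v w /(congr1 (col_perm (perm inj_s)^-1)); rewrite -!col_permM mulVg !col_perm1.
rewrite (card_imset _ inj_c) card_bent_code // leqnn andbT.
apply/subsetP => _ /imsetP[v /bent_codeP[a1 [a2 [b [c ->]]]] ->]; rewrite inE.
have [a1' [a2' [b' [c' e]]]] := combP a1 a2 b c.
apply/bent_codeP; exists a1', a2', b', c'.
by apply/rowP => i; rewrite !mxE permE u'K e.
Qed.
End Code.

(** * Reduction of every bent pair to the multiplication of GF(4) *)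

Lemma bent_bentb p q f : trace_chart p q ->
  bent f <-> bentb [seq f (p s) != 0 | s <- pts].
Proof.
move=> H.
have wE b c : (forall x, tr (b * x) = (bitdot c (q x))%:R) ->
    weight (fun x => f x + tr (b * x)) =
    count (fun r => r.1 (+) bitdot c r.2) (zip [seq f (p s) != 0 | s <- pts] pts).
  move=> bc; rewrite (weight_chart _ H) -[X in zip _ X]map_id zip_map count_map.
  by apply: eq_in_count => s hs /=; rewrite bc F2_addb F2_natr_neq0 (chart_ptsK H).
split=> [/bent_weight h|/allP h].
  by apply/allP => c /(chart_dot H)[b bc]; rewrite -(wE b).
apply/bent_weight => b; have [c hc bc] := chart_tr H b.
by rewrite (wE b c bc) h.
Qed.

Definition gf4_bent1 q : F -> 'F_2 := fun x => (gf4_mul1 (q x))%:R.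
Definition gf4_bent2 q : F -> 'F_2 := fun x => (gf4_mul2 (q x))%:R.

Lemma gf4_bent_vectorial p q : trace_chart p q ->
  bent_vectorial (gf4_bent1 q) (gf4_bent2 q).
Proof.
move=> H; have [b1 b2 b3] := gf4_bent.
by split; apply/(bent_bentb _ H); [move: b1|move: b2|move: b3];
   congr is_true; congr bentb; apply/eq_in_map => s hs;
   rewrite ?F2_addb ?F2_natr_neq0 (chart_ptsK H).
Qed.

Lemma bent_normalize p q f : trace_chart p q -> bent f ->
  exists b c, [seq f (p s) + (tr (b * p s) + c) != 0 | s <- pts] \in normal_bents.
Proof.
move=> H bf; pose v s := f (p s) != 0.
(* The affine function to add interpolates [f] at the origin and the four unit vectors: its
   coefficients are the differences from the value at the origin. *)
have [b bE] : exists b, forall x, tr (b * x) = (bitdot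
    [:: v [:: true; false; false; false] (+) v [:: false; false; false; false];
        v [:: false; true; false; false] (+) v [:: false; false; false; false];
        v [:: false; false; true; false] (+) v [:: false; false; false; false];
        v [:: false; false; false; true] (+) v [:: false; false; false; false]] (q x))%:R.
  by apply: (chart_dot H); rewrite mem_bitseqs.
exists b, (v [:: false; false; false; false])%:R.
have := bent_add_affine b (v [:: false; false; false; false])%:R bf.
move=> /(bent_bentb _ H) hb; rewrite mem_filter hb andTb.
set w := (X in X \in _); apply/mapP.
(* The positions other than 0, 1, 2, 4 and 8, where the normalized word vanishes. *)
exists [seq nth false w i | i <- [:: 3; 5; 6; 7; 9; 10; 11; 12; 13; 14; 15]%N].
  by rewrite mem_bitseqs.
rewrite {}/w /= !bE !F2_addb !F2_natr_neq0 !(chart_ptsK H) //.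
rewrite -!/(v _) /bitdot /= !andbF.
by case: (v [:: false; false; false; false]); case: (v [:: true; false; false; false]);
   case: (v [:: false; true; false; false]); case: (v [:: false; false; true; false]);
   case: (v [:: false; false; false; true]).
Qed.

Lemma gf4_codeP p q f : trace_chart p q ->
    [seq f (p s) != 0 | s <- pts] \in gf4_code ->
  exists a1 a2 b c, f =1 bent_comb (gf4_bent1 q) (gf4_bent2 q) a1 a2 b c.
Proof.
move=> H /allpairsP[[[a1 a2] q']] [_ /allpairsP[[d c] [hd _ ->]] /eq_in_map e].
have [b bE] := chart_dot H hd.
exists a1%:R, a2%:R, b, c%:R => x; rewrite [LHS]F2_neq0E.
have := e (q x) (chart_pts H x); rewrite (chart_fieldK H) => -> /=.
rewrite /bent_comb bE /gf4_bent1 /gf4_bent2 !F2_natr_addb.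
by rewrite -!mulnb !natrM.
Qed.

(** Affine corrections make both functions normal. The classification then gives a linear map
    carrying both into the reference code, and transporting it to [F] gives the required
    substitution. *)
Lemma bent_code_equiv_gf4 (u : 'I_16 -> F) p q f g :
    bijective u -> trace_chart p q -> bent_vectorial f g ->
  code_equiv (bent_code u f g) (bent_code u (gf4_bent1 q) (gf4_bent2 q)).
Proof.
move=> bij_u H bv; have [bf bg bfg] := bv.
have [bF [cF nF]] := bent_normalize H bf.
have [bG [cG nG]] := bent_normalize H bg.
pose f' x := f x + (tr (bF * x) + cF); pose g' x := g x + (tr (bG * x) + cG).
have /implyP classif := allP (allP normal_bents_classification _ nF) _ nG.
have /classif/hasP[_ /mapP[t ht ->] /andP[hF hG]] : bentb
    (bitadd [seq f' (p s) != 0 | s <- pts] [seq g' (p s) != 0 | s <- pts]).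
  (* The sum of the normalized functions differs from [f + g] by an affine function, hence is
     bent. *)
  have /(bent_bentb _ H) := bent_add_affine (bF + bG) (cF + cG) bfg.
  congr is_true; congr bentb; rewrite /bitadd zip_map -map_comp.
  by apply/eq_in_map => s _ /=; rewrite -F2_addb mulrDl trD /f' /g'; congr (_ != 0); ring.
have /and3P[/allP Apts /allP Ainj /allP Alin] := allP linear_map_linear_perm _ ht.
pose P x := p (linear_map t (q x)).
have Pp s : s \in pts -> P (p s) = p (linear_map t s).
  by move=> hs; rewrite /P (chart_ptsK H).
have injP : injective P.
  move=> x y /(congr1 q); rewrite !(chart_ptsK H) ?Apts ?(chart_pts H) // => /eqP.
  have /allP/(_ _ (chart_pts H y))/implyP h := Ainj _ (chart_pts H x).
  by move=> /h /eqP /(can_inj (chart_fieldK H)).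
have pbE (h : F -> 'F_2) : pullback [seq index (linear_map t s) pts | s <- pts]
    [seq h (p s) != 0 | s <- pts] = [seq (h \o P) (p s) != 0 | s <- pts].
  rewrite /pullback -map_comp; apply/eq_in_map => s hs.
  by rewrite /comp (nth_map [::]) ?index_mem ?Apts // nth_index ?Apts // Pp.
(* This is the third clause of [linear_perm], read through the chart. *)
have trP b : exists b', forall x, tr (b * P x) = tr (b' * x).
  have [c hc bc] := chart_tr H b.
  have /hasP[d hd /allP cd] := Alin _ hc.
  have [b' bd] := chart_dot H hd; exists b' => x.
  rewrite bc bd /P (chart_ptsK H) ?Apts ?(chart_pts H) //.
  by rewrite (eqP (cd _ (chart_pts H x))).
rewrite (pbE f') in hF; rewrite (pbE g') in hG.
have [a1F [a2F [b1 [c1 eF]]]] := gf4_codeP H hF.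
have [a1G [a2G [b2 [c2 eG]]]] := gf4_codeP H hG.
apply: (bent_code_equiv bij_u bv (gf4_bent_vectorial H) injP) => a1 a2 b c.
have [bF' bF'E] := trP bF; have [bG' bG'E] := trP bG; have [b' b'E] := trP b.
have trM (a : 'F_2) z y : tr ((a != 0)%:R * z * y) = a * tr (z * y).
  by case: (F2_cases a) => ->; rewrite ?mul0r ?mul1r ?tr0.
(* The expansions of [f] and [g] after [P], with the affine corrections undone, are scaled by [a1]
   and [a2] and collected. *)
exists (a1 * a1F + a2 * a1G), (a1 * a2F + a2 * a2G),
  ((a1 != 0)%:R * (b1 + bF') + (a2 != 0)%:R * (b2 + bG') + b'),
  (a1 * (c1 + cF) + a2 * (c2 + cG) + c) => x.
have fP (h h' d k : 'F_2) : h' = h + (d + k) -> h = h' + (d + k).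
  by move=> ->; rewrite -addrA F2_addrr addr0.
have := eF x; have := eG x; rewrite /= /f' /g' bF'E bG'E => /esym /fP eGx /esym /fP eFx.
rewrite /bent_comb eFx eGx b'E /bent_comb !mulrDl !trD !trM !mulrDl !trD; ring.
Qed.

End Field16.

(** * Symmetry and transitivity of equivalence, and uniqueness of the code *)

Lemma code_equiv_sym n (C D : {vspace 'rV['F_2]_n}) : code_equiv C D -> code_equiv D C.
Proof.
move=> [s e]; exists s^-1%g; apply/setP => v; rewrite inE.
have inD w : (col_perm s w \in D) = (w \in C).
  have /setP/(_ (col_perm s w)) := e; rewrite [in RHS]inE => <-.
  apply/imsetP/idP => [[w' hw' /(congr1 (col_perm s^-1))]|hw]; last by exists w.
  by rewrite -!col_permM mulVg !col_perm1 => ->.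
apply/imsetP/idP => [[w hw ->]|hv]; first by rewrite -inD -col_permM mulgV col_perm1.
by exists (col_perm s v); rewrite ?inD // -col_permM mulVg col_perm1.
Qed.

Lemma code_equiv_trans n (C D E : {vspace 'rV['F_2]_n}) :
  code_equiv C D -> code_equiv D E -> code_equiv C E.
Proof.
(* [col_perm (t * s)] applies [s] first and then [t]. *)
move=> [s es] [t et]; exists (t * s)%g; rewrite -et.
rewrite (eq_imset _ (fun v => col_permM t s v)).
have -> : [set col_perm t v | v in D] = [set col_perm t v | v in [set y in D]].
  by apply/setP => v; apply/imsetP/imsetP => -[w hw ->]; exists w; rewrite ?inE // inE in hw *.
by rewrite -es -imset_comp.
Qed.

Local Close Scope ring_scope.

Theorem theorem7 (F : finFieldType) (cardF : #|F| = 16)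
    (u : 'I_16 -> F) (bij_u : bijective u) :
  [/\ exists f1 f2 : F -> 'F_2, bent_vectorial f1 f2,
      forall f1 f2 : F -> 'F_2, bent_vectorial f1 f2 ->
        is_code 7 6 (bent_code u f1 f2)
    & forall f1 f2 g1 g2 : F -> 'F_2,
        bent_vectorial f1 f2 -> bent_vectorial g1 g2 ->
        code_equiv (bent_code u f1 f2) (bent_code u g1 g2)].
Proof.
have [p [q H]] := exists_trace_chart cardF; split.
- by exists (gf4_bent1 q), (gf4_bent2 q); apply: gf4_bent_vectorial H.
- by move=> f1 f2; apply: bent_code_is_code.
(* Both codes are compared with the code of the GF(4) multiplication in the same chart. *)
- move=> f1 f2 g1 g2 bf bg; apply: (code_equiv_trans (bent_code_equiv_gf4 cardF bij_u H bf)).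
  exact/code_equiv_sym/(bent_code_equiv_gf4 cardF bij_u H bg).
Qed.
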